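(* For every graph $G$ with $n$ vertices and rank-width $1$, $\Gamma_{\mathrm{CZ}}(|G\rangle)\le n-1$.
   Context: Graphs are finite, simple and undirected. The Pauli group $\mathcal{G}_n$ consists of all $\alpha h_1\otimes\dots\otimes h_n$ with $\alpha\in\{\pm1,\pm i\}$, $h_j\in\{I_2,X,Y,Z\}$. The $n$-qubit Clifford group is $\mathcal{C}_n=\{U\in U(2^n): U\mathcal{G}_nU^\dagger=\mathcal{G}_n\}$. For a graph $G=(V,E)$ with $V=\{1,\dots,n\}$, the graph state $|G\rangle$ is the $n$-qubit state (unique up to global phase) that is fixed by $X_v\otimes\bigotimes_{w\in N_G(v)}Z_w$ for all $v\in V$. States are considered up to global phase. CZ-complexity: a quantum algorithm consists of (1) measurements of qubits in the computational basis (measured qubits are discarded); (2) single-qubit Clifford operations; (3) two-qubit Clifford operations (elements of $\mathcal{C}_2$ applied to any pair of qubits); later operations may depend on earlier measurement outcomes. Its CZ-complexity is the maximum, over measurement outcomes, of the number of two-qubit Clifford operations. $\Gamma_{\mathrm{CZ}}(|G\rangle)$ is the minimum CZ-complexity of an algorithm that generates $|G\rangle$ from $|0\rangle^{\otimes(n+s)}$ with probability $1$ for some $s\ge0$. Rank-width: for $S\subseteq V$, $\mathrm{cutrank}_G(S)$ is the rank over $\mathbb{F}_2$ of the $S\times(V\setminus S)$ submatrix of the adjacency matrix of $G$ (zero for $S=\varnothing$). A rank-decomposition of $G$ is a pair $(T,L)$ with $T$ a tree of maximum degree at most three with at least two vertices and $L$ a bijection from $V$ to the leaves of $T$. Each edge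 $e$ of $T$ induces a partition $\{S,V\setminus S\}$ of $V$ (via the leaves of the two components of $T-e$); the width of $e$ is $\mathrm{cutrank}_G(S)$, and the width of $(T,L)$ is the maximum width of its edges. The rank-width of $G$ is the minimum width over all rank-decompositions (and $0$ if $G$ has at most one vertex). *)

(* Defs.v *)
From HB Require Import structures.
From mathcomp Require Import all_boot all_order all_algebra.
From mathcomp Require Import sesquilinear spectral complex.
From mathcomp Require Import all_classical all_reals ereal.

Set Implicit Arguments.
Unset Strict Implicit.
Unset Printing Implicit Defensive.

Import Order.TTheory GRing.Theory Num.Theory.
Local Open Scope ring_scope.

Record sgraph (V : finType) := SGraph {
  adj :> rel V;
  adj_sym : symmetric adj;
  adj_irrefl : irreflexive adj }.

Section RankWidth.

Definition cutrank (V : finType) (G : sgraph V) (S : {set V}) : nat :=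
  \rank (\matrix_(i < #|S|, j < #|~: S|)
           (G (enum_val i) (enum_val j))%:R : 'M['F_2]_(#|S|, #|~: S|)).

Definition degree (T : finType) (G : sgraph T) (x : T) : nat :=
  #|[set y | G x y]|.

(* Connected, and without simple closed walks of length at least 3. *)
Definition is_tree (T : finType) (G : sgraph T) : Prop :=
  [/\ (0 < #|T|)%N,
      forall x y : T, connect G x y
    & forall c : seq T, ucycle G c -> (size c <= 2)%N].

Definition is_rank_decomposition (V T : finType) (D : sgraph T) (L : V -> T)
    : Prop :=
  [/\ is_tree D,
      forall x, (degree D x <= 3)%N,
      (2 <= #|T|)%N,
      injective L
    & forall x, degree D x = 1%N <-> exists v, x = L v].

Definition delete_edge (T : finType) (D : rel T) (a b : T) : rel T :=
  [rel x y | D x y && ([set x; y] != [set a; b])].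

(* The vertices whose leaf lies in the component of [a] in [D] minus [ab];
   the component of [b] yields the complementary set. *)
Definition edge_side (V T : finType) (D : sgraph T) (L : V -> T) (a b : T)
    : {set V} :=
  [set v | connect (delete_edge D a b) a (L v)].

Definition decomposition_width (V T : finType) (G : sgraph V)
    (D : sgraph T) (L : V -> T) : nat :=
  \max_(ab : T * T | D ab.1 ab.2) cutrank G (edge_side D L ab.1 ab.2).

Definition decomposition_widths (V : finType) (G : sgraph V) : set nat :=
  [set k | exists (T : finType) (D : sgraph T) (L : V -> T),
     is_rank_decomposition D L /\ k = decomposition_width G D L]%classic.

Definition is_minimum (P : set nat) (k : nat) : Prop :=
  P k /\ forall j, P j -> (k <= j)%N.

(* The default value of [xget] is never used: a graph with at least two
   vertices has a rank-decomposition. *)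
Definition rank_width (V : finType) (G : sgraph V) : nat :=
  if (#|V| <= 1)%N then 0%N else xget 0%N (is_minimum (decomposition_widths G)).

End RankWidth.

Section Qubits.
Variable C : numClosedFieldType.
Local Open Scope sesquilinear_scope.

(* Computational basis labels of [m] qubits; [label] and [index_of] translate
   between them and the row and column indices of the matrices below, so that
   [A (index_of x) (index_of y)] is the entry <x|A|y>. *)
Notation bits m := {ffun 'I_m -> 'I_2}.
Definition label (m : nat) (i : 'I_#|bits m|) : bits m := enum_val i.
Definition index_of (m : nat) (x : bits m) : 'I_#|bits m| := enum_rank x.
Definition state (m : nat) := 'cV[C]_#|bits m|.
Definition operator (m : nat) := 'M[C]_#|bits m|.

Definition sqnorm (m : nat) (psi : state m) : C := \sum_i `|psi i 0| ^+ 2.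

Definition zero_state (m : nat) : state m :=
  delta_mx (index_of [ffun=> 0]) 0.

Definition pauliX : 'M[C]_2 := \matrix_(i, j) (i != j)%:R.
Definition pauliZ : 'M[C]_2 := \matrix_(i, j) ((-1) ^+ i *+ (i == j)).
Definition pauliY : 'M[C]_2 := 'i *: (pauliX *m pauliZ).

(* The tensor product of h 0, ..., h (m-1). *)
Definition tensor (m : nat) (h : 'I_m -> 'M[C]_2) : operator m :=
  \matrix_(i, j) \prod_(q < m) h q (label i q) (label j q).

Definition pauli_group (m : nat) : set (operator m) :=
  [set P | exists (alpha : C) (h : 'I_m -> 'M[C]_2),
     [/\ alpha \in [:: 1; -1; 'i; - 'i],
         forall q, h q \in [:: 1%:M; pauliX; pauliY; pauliZ]
       & P = alpha *: tensor h]]%classic.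

Definition clifford (m : nat) (U : operator m) : Prop :=
  U \is unitarymx /\
  [set U *m P *m U ^t* | P in @pauli_group m]%classic = @pauli_group m.

(* [U] acting on the qubits [f 0, ..., f (k-1)] of an [m]-qubit register and
   the identity acting on the others; meant for injective [f]. *)
Definition act_on (k m : nat) (f : 'I_k -> 'I_m) (U : operator k)
    : operator m :=
  \matrix_(i, j)
    (U (index_of [ffun a => label i (f a)]) (index_of [ffun a => label j (f a)])
     *+ [forall q, (q \notin codom f) ==> (label i q == label j q)]).

Definition insert_bit (m : nat) (q : 'I_m.+1) (b : 'I_2) (x : bits m)
    : bits m.+1 :=
  [ffun r => if unlift q r is Some r' then x r' else b].

(* <b|_q applied to [psi]: the unnormalised state of the remaining [m] qubits,
   kept in their order, when a measurement of qubit [q] returns [b]. *)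
Definition project (m : nat) (q : 'I_m.+1) (b : 'I_2) (psi : state m.+1)
    : state m :=
  \col_i psi (index_of (insert_bit q b (label i))) 0.

Definition normalize (m : nat) (psi : state m) : state m :=
  (sqrtC (sqnorm psi))^-1 *: psi.

(* Adaptive algorithms acting on a register of [m] qubits and ending with
   [n] qubits. The continuation of [Measure] is chosen by the outcome. *)
Inductive algorithm (n : nat) : nat -> Type :=
| Stop : algorithm n n
| Measure (m : nat) (q : 'I_m.+1) (next : 'I_2 -> algorithm n m) :
    algorithm n m.+1
| Gate1 (m : nat) (U : operator 1) (_ : clifford U) (q : 'I_m)
    (next : algorithm n m) : algorithm n m
| Gate2 (m : nat) (U : operator 2) (_ : clifford U) (q r : 'I_m) (_ : q != r)
    (next : algorithm n m) : algorithm n m.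

Fixpoint cz_complexity (n m : nat) (A : algorithm n m) : nat :=
  match A with
  | Stop => 0
  | Measure _ _ next => \max_(b < 2) cz_complexity (next b)
  | Gate1 _ _ _ _ next => cz_complexity next
  | Gate2 _ _ _ _ _ _ next => (cz_complexity next).+1
  end.

(* The probability that [A], run on the normalised state [psi], ends in a
   state satisfying [good]. A measurement outcome [b] of qubit [q] has
   probability [sqnorm (project q b psi)]; outcomes of probability 0
   contribute nothing. *)
Fixpoint success_probability (n : nat) (good : state n -> bool) (m : nat)
    (A : algorithm n m) : state m -> C :=
  match A in algorithm _ m return state m -> C with
  | Stop => fun psi => (good psi)%:R
  | Measure _ q next => fun psi =>
      \sum_(b < 2) sqnorm (project q b psi) *
        success_probability good (next b) (normalize (project q b psi))
  | Gate1 _ U _ q next => fun psi =>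
      success_probability good next (act_on (fun _ : 'I_1 => q) U *m psi)
  | Gate2 _ U _ q r _ next => fun psi =>
      success_probability good next
        (act_on (fun a : 'I_2 => if a == 0 then q else r) U *m psi)
  end.

Definition stabilizer (n : nat) (G : sgraph 'I_n) (v : 'I_n) : operator n :=
  tensor (fun w => if w == v then pauliX
                   else if G v w then pauliZ else 1%:M).

(* These conditions determine the unit vector [psi] up to a global phase:
   they say that [psi] represents the state |G>. *)
Definition is_graph_state (n : nat) (G : sgraph 'I_n) (psi : state n) : bool :=
  (sqnorm psi == 1) && [forall v, stabilizer G v *m psi == psi].

Definition generates (n s : nat) (A : algorithm n (n + s)) (G : sgraph 'I_n)
    : Prop :=
  success_probability (is_graph_state G) A (zero_state (n + s)) = 1.

End Qubits.

(* The minimum CZ-complexity of an algorithm generating |G>, as an extended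
   real number (the infimum of a nonempty set of natural numbers is attained;
   it would be +oo if no algorithm generated |G>). *)
Definition Gamma_CZ (R : realType) (n : nat) (G : sgraph 'I_n) : \bar R :=
  ereal_inf [set k | exists (s : nat) (A : algorithm R[i] n (n + s)),
               generates A G /\ k = (cz_complexity A)%:R%:E]%classic.

(* Main.v *)
(* Rank-width 1 means that G can be built from one vertex by adding vertices
   that are isolated, pendant or twins: if every part of a rank-decomposition
   has cut-rank at most 1, then after reducing two sibling parts to single
   vertices s1 and s2, the rows of s1 and s2 towards the rest are dependent over
   F_2, so one of them vanishes or they agree. Adding v next to w changes
   the state sum_x (-1)^q(x) |x>, q quadratic, by replacing x_w with
   x_w + f x_v (f = 1 for twins, f = 0 otherwise) and adding the term
   G(v,w) x_v x_w to q; this is a Hadamard gate on v followed by one two-qubit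
   gate CZ^G(v,w) CNOT^f. Hence n - 1 two-qubit gates suffice, without ancillas
   or measurements. *)
From mathcomp Require Import all_boot all_order all_algebra.
From mathcomp Require Import sesquilinear spectral complex ring.
From mathcomp Require Import all_classical all_reals ereal.
Require Import Defs.

Set Implicit Arguments.
Unset Strict Implicit.
Unset Printing Implicit Defensive.

Import Order.TTheory GRing.Theory Num.Theory.
Local Open Scope ring_scope.

(** * Cut sets of a rank-decomposition *)

Section Tree.
Variables (T : finType) (D : sgraph T).
Hypothesis treeD : is_tree D.

(** Cutting at the vertex [a] describes all branches at [a] by a single relation, whereas
    [delete_edge] changes with the branch. *)
Definition avoiding (a : T) : rel T := [rel x y | [&& D x y, x != a & y != a]].

Lemma avoiding_sym a : symmetric (avoiding a).
Proof. by move=> x y; rewrite /avoiding /= (adj_sym D) [X in _ && X]andbC. Qed.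

Lemma delete_edgeE a b x y :
  delete_edge D a b x y = D x y && ~~ ((x == a) && (y == b) || (x == b) && (y == a)).
Proof.
rewrite /delete_edge /=; case Dxy: (D x y) => //=; congr negb.
have neq z : D z z = false by exact: adj_irrefl.
apply/eqP/idP => [E|].
  have := set21 x y; rewrite E !inE => /orP[]/eqP xE; have := set22 x y;
  rewrite E !inE => /orP[]/eqP yE; rewrite xE yE !eqxx ?orbT //.
    by move: Dxy; rewrite xE yE neq.
  by move: Dxy; rewrite xE yE neq.
by case/orP=> /andP[/eqP-> /eqP->] //; rewrite finset.setUC.
Qed.

Lemma connect_avoiding_neq a c x : connect (avoiding a) c x -> c != a -> x != a.
Proof.
case/connectP=> p; elim: p c => [|y p IH] c /=; first by move=> _ ->.
by case/andP=> /and3P[_ _ ya] yp xE _; exact: (IH y).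
Qed.

Lemma connect_avoiding_path a c p :
  path D c p -> a \notin c :: p -> connect (avoiding a) c (last c p).
Proof.
move=> cp acp; apply/connectP; exists p => //.
elim: p c cp acp => //= d p IH c /andP[Dcd dp].
rewrite !inE !negb_or => /and3P[ac ad nap].
by rewrite (IH d) ?inE ?negb_or ?ad // andbT /avoiding /= Dcd (eq_sym c) ac (eq_sym d).
Qed.

(** A simple path from [c] to [a] in the cut tree would close up with the edge [ac] to a cycle.
    Acyclicity leaves only the path along [ca] itself, which is deleted. *)
Lemma bridge a c : D a c -> ~~ connect (delete_edge D c a) c a.
Proof.
move=> Dac; apply/negP => /connectP[p0 pP0 laP0].
case: treeD => _ _ acyclic.
case/shortenP: pP0 laP0 => p pP up _ aE.
have pD : path D c p by apply: sub_path pP => x y; rewrite delete_edgeE => /andP[].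
have : ucycle D (c :: p).
  by apply/andP; split=> //; rewrite /= rcons_path pD -aE Dac.
move/acyclic.
case: p pP up aE pD => [|y [|z p]] //=.
  by move=> _ _ ac; rewrite ac adj_irrefl in Dac.
by rewrite delete_edgeE => /andP[/andP[_ /negP n] _] _ ay; case: n; rewrite ay !eqxx.
Qed.

(* Deleting the edge [ca] separates [c] from [a], so that walks from [c] never meet [a]. *)
Lemma connect_delete_edge a c x : D a c ->
  connect (delete_edge D c a) c x = connect (avoiding a) c x.
Proof.
move=> Dac; apply/idP/idP; last first.
  apply: connect_sub => y z /and3P[Dyz ya za]; apply: connect1.
  by rewrite delete_edgeE Dyz (negPf ya) (negPf za) /= !andbF.
case/connectP=> p pP ->; apply/connectP; exists p => //.
have nb := bridge Dac.
(* The induction ranges over walks from any vertex reachable from [c]; by [bridge] no such vertex is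
   [a]. *)
have : forall y, connect (delete_edge D c a) c y -> path (delete_edge D c a) y p ->
    path (avoiding a) y p; last by apply=> //; exact: connect0.
elim: p {pP x} => //= z p IH y cy /andP[yz zp].
have cz : connect (delete_edge D c a) c z by exact: connect_trans cy (connect1 yz).
rewrite IH // andbT; apply/and3P; split.
- by move: yz; rewrite delete_edgeE => /andP[].
- by apply: contraNneq nb => ya; rewrite ya in cy.
- by apply: contraNneq nb => za; rewrite za in cz.
Qed.

(** A simple path from [a] never returns to [a]: after its first step, to some [c] other than [b],
    it stays in one branch at [a]. *)
Lemma connect_through a b x : D a b ->
  connect (delete_edge D a b) a x =
  (x == a) || [exists c, [&& D a c, c != b & connect (avoiding a) c x]].
Proof.
move=> Dab; apply/idP/idP; last first.
  case/orP=> [/eqP->|/existsP[c /and3P[Dac cb cx]]]; first exact: connect0.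
  apply: (@connect_trans _ _ c).
    apply: connect1; rewrite delete_edgeE Dac eqxx (negPf cb) /=.
    by rewrite negb_and; apply/orP; left; apply: contraTneq Dab => ->; rewrite adj_irrefl.
  move: cx; apply: connect_sub => y z /and3P[Dyz ya za]; apply: connect1.
  by rewrite delete_edgeE Dyz (negPf ya) (negPf za) /= andbF.
case/connectP=> p0 pP0 xE0; case/shortenP: pP0 xE0 => p pP up _ ->.
case: p pP up => [|c p] /=; first by rewrite eqxx.
rewrite delete_edgeE => /andP[/andP[Dac nc] cp] /andP[acp _].
apply/orP; right; apply/existsP; exists c; rewrite Dac /=; apply/andP; split.
  by apply: contraNneq nc => ->; rewrite !eqxx.
apply: connect_avoiding_path acp; apply: sub_path cp => y z.
by rewrite delete_edgeE => /andP[].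
Qed.

(** If the branches met, one could walk from [c] through [x] to [d] and on to [a] without the edge
    [ca], against [bridge]. *)
Lemma avoiding_disjoint a c d x : D a c -> D a d -> c != d ->
  connect (avoiding a) c x -> connect (avoiding a) d x -> False.
Proof.
move=> Dac Dad cd cx dx; have := bridge Dac; rewrite (@connect_trans _ _ d) //.
  rewrite connect_delete_edge //; apply: connect_trans cx _.
  by rewrite (sym_connect_sym (avoiding_sym a)).
apply: connect1; rewrite delete_edgeE (adj_sym D) Dad (eq_sym d) (negPf cd) /=.
by rewrite negb_and orbC; apply/orP; left; apply: contraTneq Dac => ->; rewrite adj_irrefl.
Qed.

End Tree.

(** * Building graphs of rank-width 1 vertex by vertex *)

Section Elimination.
Variables (V : finType) (G : sgraph V).

(** These model the leaf sets of subtrees in a decomposition of width at most 1, with the tree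
    forgotten. Singletons need no bound, since a one-row matrix has rank at most 1. *)
Inductive mergeable : {set V} -> Prop :=
| MergeableSingleton v : mergeable [set v]
| MergeableUnion (S1 S2 : {set V}) : mergeable S1 -> mergeable S2 ->
    [disjoint S1 & S2] -> (cutrank G (S1 :|: S2) <= 1)%N ->
    mergeable (S1 :|: S2).

(* [f = false]: isolated or pendant at [w]; [f = true]: a twin of [w]. The
   adjacency of [v] and [w] itself is unconstrained. *)
Definition attachable (W : {set V}) (v w : V) (f : bool) : Prop :=
  forall t, t \in W -> t != w -> G v t = f && G w t.

Inductive buildable : {set V} -> Prop :=
| BuildableSingleton v : buildable [set v]
| BuildableAttach (W : {set V}) v w f : buildable W -> v \notin W ->
    w \in W -> attachable W v w f -> buildable (v |: W).

Lemma F2_cases (x : 'F_2) : x = 0 \/ x = 1.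
Proof. by case: x => [[|[|//]] p]; [left|right]; apply: val_inj. Qed.

(** A nonzero row spans the row space, and a scalar of ['F_2] is 0 or 1. *)
Lemma rank1_rows (m n : nat) (M : 'M['F_2]_(m, n)) (i j : 'I_m) :
  (\rank M <= 1)%N -> [\/ row i M = 0, row j M = 0 | row i M = row j M].
Proof.
move=> rM; have [->|ri] := eqVneq (row i M) 0; first by constructor 1.
have /eqmxP/eqmx_sym/eqmxP : (row i M == M)%MS.
  rewrite -(geq_leqif (mxrank_leqif_eq (row_sub i M))) (leq_trans rM) //.
  by rewrite lt0n mxrank_eq0.
case/andP=> + _; move/(submx_trans (row_sub j M))/sub_rVP => [a ->].
by case: (F2_cases a) => ->; rewrite ?scale0r ?scale1r; [constructor 2|constructor 3].
Qed.

Lemma cutrank1_rows (S : {set V}) s1 s2 : (cutrank G S <= 1)%N ->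
    s1 \in S -> s2 \in S ->
  [\/ forall t, t \notin S -> G s1 t = false,
      forall t, t \notin S -> G s2 t = false
    | forall t, t \notin S -> G s1 t = G s2 t].
Proof.
move=> rS s1S s2S; have inS t : t \notin S -> t \in ~: S by rewrite inE.
have entry s t (sS : s \in S) (tS : t \notin S) :
    (\matrix_(i < #|S|, j < #|~: S|)
           (G (enum_val i) (enum_val j))%:R : 'M['F_2]_(#|S|, #|~: S|))
      (enum_rank_in sS s) (enum_rank_in (inS _ tS) t) = (G s t)%:R.
  by rewrite mxE !enum_rankK_in // inE.
have natF2 (b : bool) : (b%:R : 'F_2) = 0 -> b = false by case: b.
case: (rank1_rows (enum_rank_in s1S s1) (enum_rank_in s2S s2) rS) => /rowP E;
  [constructor 1|constructor 2|constructor 3] => t tS;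
  have := E (enum_rank_in (inS _ tS) t); rewrite [LHS]mxE entry.
- by rewrite mxE => /natF2.
- by rewrite mxE => /natF2.
- by rewrite mxE entry; case: (G s1 t); case: (G s2 t) => // /eqP.
Qed.

(** The set [S] is contracted to a representative [s] in the presence of the remaining vertices [R].
    The induction varies [R]: first [S1] is contracted next to [S2 :|: R], then [S2] next to
    [s1 |: R], and finally one of [s1], [s2] is attached to the other. *)
Lemma mergeable_buildable (S : {set V}) : mergeable S ->
  forall R : {set V}, [disjoint S & R] ->
  exists2 s, s \in S & buildable (s |: R) -> buildable (S :|: R).
Proof.
elim=> {S} [v R _|S1 S2 _ IH1 _ IH2 S12 rS R SR].
  by exists v; rewrite ?inE.
have disjU (A B C : {set V}) :
    [disjoint A & B :|: C] = [disjoint A & B] && [disjoint A & C].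
  by rewrite -!setI_eq0 finset.setIUr finset.setU_eq0.
have /andP[RS1 RS2] : [disjoint R & S1] && [disjoint R & S2].
  by rewrite -disjU disjoint_sym.
have [|s1 s1S1 H1] := IH1 (S2 :|: R); first by rewrite disjU S12 disjoint_sym.
have [|s2 s2S2 H2] := IH2 (s1 |: R).
  rewrite disjU andbC disjoint_sym RS2 disjoint_sym disjoints1.
  by rewrite (disjointFr S12 s1S1).
have s12 : s1 != s2 by apply: contraTneq s2S2 => <-; rewrite (disjointFr S12 s1S1).
have build : buildable (s2 |: (s1 |: R)) -> buildable (S1 :|: S2 :|: R).
  by rewrite -finset.setUA => /H2; rewrite finset.setUCA => /H1.
have outS t : t \in R -> t \notin S1 :|: S2 by move/(disjointFl SR) ->.
have [s1S s2S] : s1 \in S1 :|: S2 /\ s2 \in S1 :|: S2.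
  by rewrite !inE s1S1 s2S2 orbT.
have [s1R s2R] : s1 \notin R /\ s2 \notin R.
  by rewrite (disjointFr SR s1S) (disjointFr SR s2S).
(* A vertex with vanishing row is isolated or pendant at the other one; equal rows make [s2] a twin
   of [s1]. The vertex that is not attached remains as representative. *)
case: (cutrank1_rows rS s1S s2S) => rows.
- exists s2 => // b2; apply: build; rewrite finset.setUCA.
  apply: (BuildableAttach (w := s2) (f := false)) => //.
  + by rewrite !inE negb_or s12.
  + by rewrite !inE eqxx.
  + move=> t; rewrite !inE => /orP[->//|tR] _; exact/rows/outS.
- exists s1 => // b1; apply: build.
  apply: (BuildableAttach (w := s1) (f := false)) => //.
  + by rewrite !inE negb_or eq_sym s12.
  + by rewrite !inE eqxx.
  + move=> t; rewrite !inE => /orP[->//|tR] _; exact/rows/outS.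
- exists s1 => // b1; apply: build.
  apply: (BuildableAttach (w := s1) (f := true)) => //.
  + by rewrite !inE negb_or eq_sym s12.
  + by rewrite !inE eqxx.
  + move=> t; rewrite !inE => /orP[->//|tR] _; exact/esym/rows/outS.
Qed.

End Elimination.

(** * From rank-decompositions to buildable graphs *)

Section Decomposition.
Variables (V T : finType) (G : sgraph V) (D : sgraph T) (L : V -> T).
Hypothesis decD : is_rank_decomposition D L.
Hypothesis widthD : (decomposition_width G D L <= 1)%N.

Lemma cutrank_edge_side a b : D a b -> (cutrank G (edge_side D L a b) <= 1)%N.
Proof.
move=> Dab; apply: leq_trans widthD.
exact: (@leq_bigmax_cond _ _ (fun ab => cutrank G (edge_side D L ab.1 ab.2)) (a, b)).
Qed.

Definition branch (a c : T) : {set T} := [set x | connect (avoiding D a) c x].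

Lemma edge_side_branch a c : D a c ->
  edge_side D L c a = [set v | L v \in branch a c].
Proof.
case: decD => treeD _ _ _ _ Dac; apply/setP => v.
by rewrite !inE (connect_delete_edge treeD _ Dac).
Qed.

Lemma mem_edge_side a b v : D a b ->
  (v \in edge_side D L a b) =
  (L v == a) || [exists c, [&& D a c, c != b & v \in edge_side D L c a]].
Proof.
case: decD => treeD _ _ _ _ Dab.
rewrite !inE (connect_through _ Dab); congr (_ || _).
apply: eq_existsb => c; case Dac: (D a c) => //=.
by rewrite edge_side_branch // !inE.
Qed.

(** This makes the recursion away from an edge terminate: [branch a c] misses [a]. *)
Lemma branch_proper a b c : D a b -> D a c -> c != b ->
  branch a c \proper branch b a.
Proof.
case: decD => treeD _ _ _ _ Dab Dac cb; have Dba : D b a by rewrite (adj_sym D).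
have ca : c != a by apply: contraTneq Dac => ->; rewrite adj_irrefl.
apply/fintype.properP; split.
  apply/fintype.subsetP => x; rewrite !inE -(connect_delete_edge treeD _ Dba) => cx.
  rewrite (connect_through _ Dab); apply/orP; right.
  by apply/existsP; exists c; rewrite Dac cb.
exists a; rewrite !inE ?connect0 //.
by apply/negP => /connect_avoiding_neq /(_ ca); rewrite eqxx.
Qed.

(** Apart from [b], the vertex [a] has at most two neighbours. With two, the side is the disjoint
    union of theirs, and the edge [ab] bounds its cut-rank; with one, the side is unchanged; with
    none, [a] is a leaf. *)
Lemma mergeable_edge_side a b : D a b -> mergeable G (edge_side D L a b).
Proof.
have [k] := ubnP #|branch b a|; elim: k => // k IH in a b *.
rewrite ltnS => bk Dab.
have IHc c : D a c -> c != b -> mergeable G (edge_side D L c a).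
  move=> Dac cb; apply: IH; last by rewrite (adj_sym D).
  exact: leq_trans (proper_card (branch_proper Dab Dac cb)) bk.
case: decD => treeD deg3 _ injL leaf.
have bN : b \in [set y | D a y] by rewrite inE.
have degE : degree D a = #|[set y | D a y] :\ b|.+1.
  by rewrite /degree (cardsD1 b) bN.
have NP c : (c \in [set y | D a y] :\ b) = D a c && (c != b).
  by rewrite !inE andbC.
have := deg3 a; rewrite degE ltnS leq_eqVlt ltnS leq_eqVlt ltnS leqn0.
(* A vertex [a] with a neighbour besides [b] has degree at least 2, so no graph vertex sits at [a]
   itself. *)
have noleaf : #|[set y | D a y] :\ b| != 0%N -> forall v, (L v == a) = false.
  move=> n0 v; apply/negP => /eqP La; case/negP: n0.
  by rewrite -eqSS -degE; apply/eqP/leaf; exists v.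
case/or3P.
- move/cards2P => [c [d [cd NE]]].
  have /andP[Dac cb] : D a c && (c != b) by rewrite -NP NE !inE eqxx.
  have /andP[Dad db] : D a d && (d != b) by rewrite -NP NE !inE eqxx orbT.
  have n0 := noleaf; rewrite NE cards2 cd in n0.
  have E : edge_side D L a b = edge_side D L c a :|: edge_side D L d a.
    apply/setP => v; rewrite mem_edge_side // (n0 isT) /= finset.in_setU.
    apply/existsP/orP => [[e /and3P[Dae eb ve]]|[ve|ve]].
    + have : e \in [set c; d] by rewrite -NE NP Dae.
      by rewrite finset.in_set2 => /orP[]/eqP ed; rewrite ed in ve; [left|right].
    + by exists c; rewrite Dac cb.
    + by exists d; rewrite Dad db.
  rewrite E; constructor; [exact: IHc|exact: IHc| |by rewrite -E cutrank_edge_side].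
  rewrite -setI_eq0; apply/eqP/setP => v; rewrite !inE.
  rewrite (connect_delete_edge treeD _ Dac) (connect_delete_edge treeD _ Dad).
  by apply/negP => /andP[]; exact: avoiding_disjoint.
- move/cards1P => [c NE].
  have /andP[Dac cb] : D a c && (c != b) by rewrite -NP NE !inE eqxx.
  have n0 := noleaf; rewrite NE cards1 in n0.
  suff -> : edge_side D L a b = edge_side D L c a by exact: IHc.
  apply/setP => v; rewrite mem_edge_side // (n0 isT) /=.
  apply/existsP/idP => [[e /and3P[Dae eb ve]]|ve].
  + have : e \in [set c] by rewrite -NE NP Dae.
    by rewrite finset.in_set1 => /eqP ec; rewrite ec in ve.
  + by exists c; rewrite Dac cb.
- rewrite cards_eq0 => /eqP NE.
  have [v La] : exists v, a = L v by apply/leaf; rewrite degE NE cards0.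
  suff -> : edge_side D L a b = [set v] by constructor.
  apply/setP => u; rewrite mem_edge_side // finset.in_set1 La (inj_eq injL) -La.
  case: eqP => //= _; apply/existsP => -[e /and3P[Dae eb _]].
  by have := NP e; rewrite NE inE Dae eb.
Qed.

(** Any tree edge splits the vertex set into two mergeable sides. Contracting their union with
    nothing left over ends at a single vertex. *)
Lemma buildable_of_decomposition : buildable G [set: V].
Proof.
case: (decD) => treeD deg3 T2 injL leaf.
have [_ conD _] := treeD.
have [a [b Dab]] : exists a b, D a b.
  have /card_gt1P[x [y [_ _ xy]]] := T2.
  case/connectP: (conD x y) => -[|z p] /=; first by move=> _ yx; rewrite yx eqxx in xy.
  by case/andP=> Dxz _ _; exists x, z.
have Dba : D b a by rewrite (adj_sym D).
have sideU : edge_side D L a b :|: edge_side D L b a = [set: V].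
  apply/setP => v; rewrite !inE (connect_through _ Dab).
  rewrite (connect_delete_edge treeD _ Dab).
  case/connectP: (conD a (L v)) => p0 pP0 vE0.
  case/shortenP: pP0 vE0 => p pP up _ ->.
  case: p pP up => [|c p] /=; first by rewrite eqxx.
  case/andP=> Dac cp /andP[acp _].
  have cx := connect_avoiding_path cp acp.
  have [<-|cb] := eqVneq c b; first by rewrite cx orbT.
  rewrite -orbA; apply/orP; right; apply/orP; left.
  by apply/existsP; exists c; rewrite Dac cb.
have sides : [disjoint edge_side D L a b & edge_side D L b a].
  rewrite -setI_eq0; apply/eqP/setP => v; rewrite !inE.
  rewrite (connect_through _ Dab) (connect_delete_edge treeD _ Dab).
  have ba : b != a by apply: contraTneq Dab => ->; rewrite adj_irrefl.
  apply/negP => /andP[/orP[/eqP La|/existsP[c /and3P[Dac cb cx]]] bx].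
    by have := connect_avoiding_neq bx ba; rewrite La eqxx.
  exact: avoiding_disjoint Dac Dab cb cx bx.
have : mergeable G [set: V].
  rewrite -sideU; constructor; rewrite ?sideU //; try exact: mergeable_edge_side.
  (* The cut matrix of the whole vertex set has no columns. *)
  by apply: leq_trans (rank_leq_col _) _; rewrite finset.setCT cards0.
case/mergeable_buildable/(_ finset.set0) => [|s _]; first by rewrite finset.disjoints_subset finset.setC0.
by rewrite !finset.setU0; apply; constructor.
Qed.

End Decomposition.

Lemma rank_width1_buildable (V : finType) (G : sgraph V) :
  rank_width G = 1%N -> buildable G [set: V].
Proof.
(* The value 1 is neither the value for at most one vertex nor the default of [xget], so some
   decomposition attains it. *)
rewrite /rank_width; case: ifP => // _; case: xgetP => // k -> [+ _] k1.
by case=> [T [D [L [decD wD]]]]; apply: buildable_of_decomposition decD _; rewrite -wD k1.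
Qed.

(** * Clifford gates and graph states *)

Local Notation bits m := {ffun 'I_m -> 'I_2}.

(** * Bit strings as vectors over F_2 *)

Section Bits.

Lemma I2_cases (a : 'I_2) : a = 0 \/ a = 1.
Proof. by case: a => [[|[|//]] p]; [left|right]; apply: val_inj. Qed.

Lemma I2_addrr (a : 'I_2) : a + a = 0.
Proof. by case: (I2_cases a) => ->; apply: val_inj. Qed.

Lemma bits_addrr m (x : bits m) : x + x = 0.
Proof. by apply/ffunP => q; rewrite !ffunE I2_addrr. Qed.

Lemma bits_addK m (x y : bits m) : x + y + y = x.
Proof. by rewrite -addrA bits_addrr addr0. Qed.

Lemma bits_addE m (x y : bits m) q : (x + y) q = x q + y q.
Proof. by rewrite ffunE. Qed.

Definition unit_bit m (q : 'I_m) (c : 'I_2) : bits m :=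
  [ffun r => if r == q then c else 0].

Lemma unit_bitE m (q r : 'I_m) c : unit_bit q c r = if r == q then c else 0.
Proof. by rewrite ffunE. Qed.

Lemma unit_bit_same m (q : 'I_m) c : unit_bit q c q = c.
Proof. by rewrite unit_bitE eqxx. Qed.

Lemma unit_bit_other m (q r : 'I_m) c : r != q -> unit_bit q c r = 0.
Proof. by rewrite unit_bitE => /negPf->. Qed.

Lemma unit_bitD m (q : 'I_m) c d :
  unit_bit q (c + d) = unit_bit q c + unit_bit q d.
Proof. by apply/ffunP => r; rewrite !ffunE; case: eqP => // _; rewrite addr0. Qed.

Lemma unit_bit0 m (q : 'I_m) : unit_bit q 0 = 0.
Proof. by apply/ffunP => r; rewrite !ffunE if_same. Qed.

End Bits.

Section Operators.
Variable C : numClosedFieldType.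
Local Open Scope sesquilinear_scope.

(** Natural-number arguments admit both bits and booleans by coercion; on bits this is a
    bicharacter. *)
Definition sgn (a b : nat) : C := (-1) ^+ (a * b).

Lemma sgnC a b : sgn a b = sgn b a.
Proof. by rewrite /sgn mulnC. Qed.

Lemma sgn0 b : sgn 0 b = 1. Proof. by []. Qed.

Lemma sgnDl (a b : 'I_2) c : sgn (a + b)%R c = sgn a c * sgn b c.
Proof.
rewrite /sgn -exprD -mulnDl.
by case: (I2_cases a) => ->; case: (I2_cases b) => -> //=; rewrite mul0n expr0 mulnC exprM sqrr_sign.
Qed.

Lemma sgnDr a (b c : 'I_2) : sgn a (b + c)%R = sgn a b * sgn a c.
Proof. by rewrite sgnC sgnDl !(sgnC a). Qed.

Lemma sgn_mulrr a b : sgn a b * sgn a b = 1.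
Proof. by rewrite /sgn -exprD addnn -muln2 exprM sqrr_sign. Qed.

Lemma sgn_exp4 a b : sgn a b ^+ 4 = 1.
Proof. by rewrite (exprM (sgn a b) 2 2) (expr2 (sgn a b)) sgn_mulrr expr1n. Qed.

Lemma conj_sgn a b : (sgn a b)^* = sgn a b.
Proof. by rewrite /sgn rmorphXn rmorphN rmorph1. Qed.

Lemma normr_sgn a b : `|sgn a b| = 1.
Proof. by rewrite /sgn normrX normrN1 expr1n. Qed.

(** Entries indexed by bit strings turn operator products into sums over bit strings, without index
    conversions. *)
Definition kernel_op m (K : bits m -> bits m -> C) : operator C m :=
  \matrix_(i, j) K (label i) (label j).

Definition amplitude m (psi : state C m) (x : bits m) : C := psi (index_of x) 0.

Lemma sum_label m (F : bits m -> C) : \sum_(i < #|bits m|) F (label i) = \sum_x F x.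
Proof. by rewrite (reindex (@label m)) //; apply/onW_bij/enum_val_bij. Qed.

Lemma index_ofK m : cancel (@index_of m) (@label m).
Proof. exact: enum_rankK. Qed.

Lemma labelK m : cancel (@label m) (@index_of m).
Proof. exact: enum_valK. Qed.

Lemma eq_kernel_op m (K K' : bits m -> bits m -> C) :
  (forall x y, K x y = K' x y) -> kernel_op K = kernel_op K'.
Proof. by move=> E; apply/matrixP => i j; rewrite !mxE E. Qed.

Lemma mul_kernel_op m (K K' : bits m -> bits m -> C) :
  kernel_op K *m kernel_op K' = kernel_op (fun x y => \sum_z K x z * K' z y).
Proof.
apply/matrixP => i j; rewrite !mxE -sum_label.
by apply: eq_bigr => k _; rewrite !mxE.
Qed.

Lemma kernel_op1 m : 1%:M = kernel_op (fun x y : bits m => (y == x)%:R).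
Proof.
by apply/matrixP => i j; rewrite !mxE (can_eq (@labelK m)) eq_sym.
Qed.

Lemma adjoint_kernel_op m (K : bits m -> bits m -> C) :
  (kernel_op K) ^t* = kernel_op (fun x y => (K y x)^*).
Proof. by apply/matrixP => i j; rewrite !mxE. Qed.

Lemma amplitude_mul m (K : bits m -> bits m -> C) psi x :
  amplitude (kernel_op K *m psi) x = \sum_y K x y * amplitude psi y.
Proof.
rewrite /amplitude mxE -sum_label; apply: eq_bigr => k _.
by rewrite !mxE index_ofK labelK.
Qed.

Lemma state_eq m (psi phi : state C m) :
  (forall x, amplitude psi x = amplitude phi x) -> psi = phi.
Proof.
move=> E; apply/matrixP => i j; rewrite ord1 -(labelK i); exact: E.
Qed.

Lemma sqnorm_amplitude m (psi : state C m) :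
  sqnorm psi = \sum_x `|amplitude psi x| ^+ 2.
Proof.
rewrite /sqnorm -sum_label; apply: eq_bigr => i _.
by rewrite /amplitude labelK.
Qed.

(** * Pauli operators in Weyl form *)

Lemma sum_mulrb_eq (I : finType) (F : I -> C) (c : I) :
  \sum_z F z *+ (z == c) = F c.
Proof.
rewrite (bigD1 c) //= eqxx big1 ?addr0 // => z /negPf->.
by [].
Qed.

Lemma prod_mulrb (I : finType) (F : I -> C) (e : pred I) :
  \prod_q (F q *+ e q) = (\prod_q F q) *+ [forall q, e q].
Proof.
case: forallP => [eT|nE]; first by apply: eq_bigr => q _; rewrite eT.
have /existsP[q /negPf eq] : [exists q, ~~ e q].
  by rewrite -negb_forall; apply/negP => /forallP.
by rewrite (bigD1 q) //= eq mul0r.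
Qed.

(* The entry <x|P|y> of P = alpha Z^b X^a. *)
Definition weyl m (alpha : C) (a b x y : bits m) : C :=
  (alpha * \prod_q sgn (b q) (x q)) *+ (y == x + a).

Definition weyl1 (a b : 'I_2) : 'M[C]_2 :=
  \matrix_(i, j) (sgn b i *+ (j == i + a)).

(** The phase of [pauliY] comes from X Z = - Z X. *)
Lemma paulis_weyl1 :
  [/\ 1%:M = weyl1 0 0, pauliX C = weyl1 1 0, pauliZ C = weyl1 0 1
    & pauliY C = - 'i *: weyl1 1 1].
Proof.
have I2E (P : 'I_2 -> 'I_2 -> Prop) : P 0 0 -> P 0 1 -> P 1 0 -> P 1 1 -> forall i j, P i j.
  by move=> ? ? ? ? i j; case: (I2_cases i) => ->; case: (I2_cases j) => ->.
split; apply/matrixP; apply: I2E; rewrite !mxE ?big_ord_recl ?big_ord0 ?mxE /= /sgn /bump;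
  do ?change (1 %% 2)%N with 1%N; rewrite ?(mulr0n, mulr1n, expr0, expr1) /=; by ring.
Qed.

Lemma pauli_phase (alpha : C) :
  (alpha \in [:: 1; -1; 'i; - 'i]) = (alpha ^+ 4 == 1).
Proof.
have E : alpha ^+ 4 - 1 = (alpha - 1) * (alpha - (-1)) * ((alpha - 'i) * (alpha - - 'i)).
  by rewrite !opprK -[(_ - 'i) * _]subr_sqr sqrCi; ring.
by rewrite -(subr_eq0 _ 1) E !mulf_eq0 !inE !subr_eq0 orbA.
Qed.

Lemma tensor_weyl m (c : 'I_m -> C) (a b : bits m) :
  tensor (fun q => c q *: weyl1 (a q) (b q)) =
  kernel_op (weyl (\prod_q c q) a b).
Proof.
apply/matrixP => i j; rewrite !mxE /weyl -big_split /=.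
have -> : (label j == label i + a) = [forall q, label j q == label i q + a q].
  apply/eqP/forallP => [-> q|E]; first by rewrite bits_addE.
  by apply/ffunP => q; rewrite bits_addE (eqP (E q)).
rewrite -prod_mulrb; apply: eq_bigr => q _.
by rewrite !mxE -mulrnAr.
Qed.

Lemma i4 : (- 'i : C) ^+ 4 = 1.
Proof. by apply/eqP; rewrite -pauli_phase !inE eqxx !orbT. Qed.

Lemma pauli_groupP m (P : operator C m) :
  @pauli_group C m P <->
  exists alpha a b, alpha ^+ 4 = 1 /\ P = kernel_op (weyl alpha a b).
Proof.
have [P1 PX PZ PY] := paulis_weyl1.
split=> [[alpha [h [al hP ->]]]|[alpha [a [b [al ->]]]]].
  have /fin_all_exists[u hu] : forall q, exists u : C * 'I_2 * 'I_2,
      u.1.1 ^+ 4 = 1 /\ h q = u.1.1 *: weyl1 u.1.2 u.2.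
    move=> q; have := hP q; rewrite !inE => /or4P[]/eqP->.
    - by exists (1, 0, 0); rewrite expr1n scale1r.
    - by exists (1, 1, 0); rewrite expr1n scale1r.
    - by exists (- 'i, 1, 1); rewrite i4.
    - by exists (1, 0, 1); rewrite expr1n scale1r.
  exists (alpha * \prod_q (u q).1.1), [ffun q => (u q).1.2], [ffun q => (u q).2].
  split.
    rewrite exprMn -prodrXl big1 ?mulr1; last by move=> q _; case: (hu q).
    by apply/eqP; rewrite -pauli_phase.
  have -> : tensor h = tensor (fun q => (u q).1.1 *:
      weyl1 ([ffun q => (u q).1.2] q) ([ffun q => (u q).2] q)).
    apply/matrixP => i j; rewrite !mxE; apply: eq_bigr => q _.
    by rewrite !ffunE; case: (hu q) => _ ->.
  rewrite tensor_weyl; apply/matrixP => i j; rewrite !mxE /weyl.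
  by rewrite -mulrnAr mulrA mulrnAr.
have /fin_all_exists[c cP] : forall q, exists c : C, c ^+ 4 = 1 /\
    c *: weyl1 (a q) (b q) \in [:: 1%:M; pauliX C; pauliY C; pauliZ C].
  move=> q; case: (I2_cases (a q)) => ->; case: (I2_cases (b q)) => ->.
  - by exists 1; rewrite scale1r -P1 !inE eqxx expr1n.
  - by exists 1; rewrite scale1r -PZ !inE eqxx expr1n !orbT.
  - by exists 1; rewrite scale1r -PX !inE eqxx expr1n !orbT.
  - by exists (- 'i); rewrite -PY !inE eqxx i4 !orbT.
have c4 : (\prod_q c q) ^+ 4 = 1.
  by rewrite -prodrXl big1 // => q _; case: (cP q).
have cu : \prod_q c q != 0.
  by apply/eqP => c0; move/eqP: c4; rewrite c0 expr0n eq_sym oner_eq0.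
(* The phases [c q] turn the factors into the listed Pauli matrices; the global phase cancels their
   product. *)
exists (alpha / \prod_q c q), (fun q => c q *: weyl1 (a q) (b q)); split.
- by rewrite pauli_phase exprMn exprVn c4 al invr1 mulr1.
- by move=> q; case: (cP q).
rewrite tensor_weyl; apply/matrixP => i j; rewrite !mxE /weyl.
by rewrite mulrnAr mulrA divfK.
Qed.

(** * Clifford gates *)

Lemma clifford_involution m (U : operator C m) : U ^t* = U -> U *m U = 1%:M ->
  (forall P, @pauli_group C m P ->
     exists2 P', @pauli_group C m P' & U *m P = P' *m U) -> clifford U.
Proof.
move=> Uh UU conj; split; first by apply/unitarymxP; rewrite Uh.
have conjP P : @pauli_group C m P -> @pauli_group C m (U *m P *m U).
  by case/conj => P' P'P ->; rewrite -mulmxA UU mulmx1.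
(* Conjugating twice by [U] is the identity, so inclusion in the Pauli group already gives
   equality. *)
rewrite Uh; apply/seteqP; split=> [_ [P /conjP PP <-] //|P /conjP PP].
by exists (U *m P *m U) => //; rewrite !mulmxA UU mul1mx -mulmxA UU mulmx1.
Qed.

Lemma clifford_mul m (U W : operator C m) :
  clifford U -> clifford W -> clifford (U *m W).
Proof.
move=> [Uu UP] [Wu WP]; split; first exact: mul_unitarymx.
rewrite -[RHS]UP -[in RHS]WP.
have conjM P : U *m W *m P *m (U *m W) ^t* = U *m (W *m P *m W ^t*) *m U ^t*.
  by rewrite trmx_mul map_mxM !mulmxA.
apply/seteqP; split=> _ [P PP <-].
  by exists (W *m P *m W ^t*); [exists P|rewrite conjM].
by case: PP => Q QP <-; exists Q; rewrite ?conjM.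
Qed.

Lemma eq_addr_bits m (x y a : bits m) : (y == x + a) = (x == y + a).
Proof. by apply/eqP/eqP => ->; rewrite bits_addK. Qed.

Lemma sum_mulrb_eql (I : finType) (F G : I -> C) (c : I) :
  \sum_z (F z *+ (z == c)) * G z = F c * G c.
Proof.
rewrite -(sum_mulrb_eq (fun z => F z * G z)).
by apply: eq_bigr => z _; rewrite mulrnAl.
Qed.

Lemma sgnCA a b c : sgn a (b * c) = sgn c (b * a).
Proof. by rewrite /sgn !(mulnCA _ b) (mulnC a). Qed.

Lemma sgn_mulrb (a b : 'I_2) (e : bool) : sgn (a *+ e)%R b = sgn a (e * b).
Proof. by case: e; rewrite ?mul1n // mul0n [RHS]sgnC. Qed.

Lemma sgn_mulDr a e (b c : 'I_2) :
  sgn a (e * (b + c)%R) = sgn a (e * b) * sgn a (e * c).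
Proof. by rewrite sgnCA sgnDl (sgnCA b) (sgnCA c). Qed.

Lemma ord1E : lift ord0 ord0 = 1 :> 'I_2.
Proof. exact: val_inj. Qed.

Lemma ord0E m : ord0 = 0 :> 'I_m.+1.
Proof. exact: val_inj. Qed.

Lemma sum_bits1 (F : bits 1 -> C) : \sum_z F z = F 0 + F (unit_bit 0 1).
Proof.
rewrite (reindex (unit_bit 0)) /=; last first.
  exists (fun z : bits 1 => z 0) => z _; first exact: unit_bit_same.
  by apply/ffunP => q; rewrite ord1 unit_bit_same.
by rewrite !big_ord_recl big_ord0 addr0 ord1E ord0E unit_bit0.
Qed.

(** For [e = false] this is the identity, which spares a case split on adjacency. *)
Definition cz (e : bool) : operator C 2 :=
  kernel_op (fun x y : bits 2 => sgn (x 0) (e * x 1%R) *+ (y == x)).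

Lemma clifford_cz e : clifford (cz e).
Proof.
apply: clifford_involution.
- rewrite adjoint_kernel_op; apply: eq_kernel_op => x y.
  by rewrite eq_sym; case: eqP => [->|_] /=; rewrite ?conj_sgn ?conjC0.
- rewrite mul_kernel_op kernel_op1; apply: eq_kernel_op => x y.
  by rewrite sum_mulrb_eql mulrnAr sgn_mulrr.
move=> _ /pauli_groupP[alpha [a [b [al ->]]]].
(* Passing from x to x + a changes x0 x1 by the linear terms x0 a1 + x1 a0, which shift [b], and by
   the constant a0 a1, which enters the phase. *)
pose b' : bits 2 := b + (unit_bit 0 (a 1 *+ e) + unit_bit 1 (a 0 *+ e)).
exists (kernel_op (weyl (alpha * sgn (a 0) (e * a 1)) a b')).
  apply/pauli_groupP; do 3 eexists; split; last by [].
  by rewrite exprMn al mul1r sgn_exp4.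
rewrite !mul_kernel_op; apply: eq_kernel_op => x y.
rewrite !sum_mulrb_eql !mulrnAr /weyl; congr (_ *+ _).
rewrite !big_ord_recl !big_ord0 !mulr1 ord1E ord0E /b'.
rewrite !bits_addE !unit_bit_same !unit_bit_other // addr0 add0r !(sgnDl, sgn_mulrb).
rewrite !sgn_mulDr (sgnCA (a 1)).
set A := sgn (x 0) (e * a 1); set B := sgn (a 0) (e * x 1).
set D := sgn (a 0) (e * a 1); set E := sgn (x 0) (e * x 1).
transitivity (E * (alpha * (sgn (b 0) (x 0) * sgn (b 1) (x 1)))
  * (A * A) * (B * B) * (D * D)); last by ring.
by rewrite !sgn_mulrr !mulr1.
Qed.

Definition flip_target (f : bool) (x : bits 2) : bits 2 := x + unit_bit 0 (x 1 *+ f).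

Lemma flip_targetD f x y : flip_target f (x + y) = flip_target f x + flip_target f y.
Proof. by rewrite /flip_target bits_addE mulrnDl unit_bitD addrACA. Qed.

Lemma flip_targetK f : involutive (flip_target f).
Proof.
by move=> x; rewrite /flip_target bits_addE unit_bitE addr0 bits_addK.
Qed.

(* Qubit 0 is the target, qubit 1 the control. *)
Definition cnot (f : bool) : operator C 2 :=
  kernel_op (fun x y : bits 2 => 1 *+ (y == flip_target f x)).

Lemma clifford_cnot f : clifford (cnot f).
Proof.
apply: clifford_involution.
- rewrite adjoint_kernel_op; apply: eq_kernel_op => x y.
  by rewrite conjC_nat -(inv_eq (@flip_targetK f)) eq_sym.
- rewrite mul_kernel_op kernel_op1; apply: eq_kernel_op => x y.
  by rewrite sum_mulrb_eql mul1r flip_targetK.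
move=> _ /pauli_groupP[alpha [a [b [al ->]]]].
(* The Z part transforms by the transpose of [flip_target f]: the pairing of [b] with
   [flip_target f x] equals that of [b'] with [x]. *)
pose b' : bits 2 := b + unit_bit 1 (b 0 *+ f).
exists (kernel_op (weyl alpha (flip_target f a) b')).
  by apply/pauli_groupP; do 3 eexists; split; last by [].
rewrite !mul_kernel_op; apply: eq_kernel_op => x y.
rewrite !sum_mulrb_eql flip_targetD flip_targetK mul1r mulr_natr /weyl.
congr (_ * _ *+ _).
rewrite !big_ord_recl !big_ord0 !mulr1 ord1E ord0E /b' /flip_target.
rewrite !bits_addE !unit_bit_same !unit_bit_other // !addr0 sgnDr sgnDl sgn_mulrb.
by rewrite (sgnC _ (x 1 *+ f)%R) sgn_mulrb sgnCA; ring.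
Qed.

Definition hadamard : operator C 1 :=
  kernel_op (fun x y : bits 1 => (sqrtC 2)^-1 * sgn (x 0) (y 0)).

Lemma clifford_hadamard : clifford hadamard.
Proof.
have s2 : ((sqrtC 2 : C)^-1)^* = (sqrtC 2)^-1.
  by apply/CrealP/ger0_real; rewrite invr_ge0 sqrtC_ge0.
apply: clifford_involution.
- rewrite adjoint_kernel_op; apply: eq_kernel_op => x y.
  by rewrite rmorphM sgnC; congr (_ * _); [exact: s2|exact: conj_sgn].
- rewrite mul_kernel_op kernel_op1; apply: eq_kernel_op => x y.
  rewrite sum_bits1 unit_bit_same ffunE.
  have half : (sqrtC 2)^-1 * (sqrtC 2)^-1 = 2^-1 :> C by rewrite -invfM -expr2 sqrtCK.
  have -> : (y == x) = (y 0 == x 0).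
    by apply/eqP/eqP => [->//|E]; apply/ffunP => q; rewrite ord1.
  rewrite mulrACA [X in _ + X]mulrACA half -mulrDr.
  have two : 2^-1 * (1 + 1) = 1 :> C by rewrite mulVf // pnatr_eq0.
  by case: (I2_cases (x 0)) => ->; case: (I2_cases (y 0)) => ->; rewrite /sgn /=
    ?(expr0, expr1, mulr1, mulrNN, two, mul1r, subrr, mulr0).
move=> _ /pauli_groupP[alpha [a [b [al ->]]]].
(* The Hadamard gate exchanges X and Z; restoring their order costs the sign. *)
exists (kernel_op (weyl (alpha * sgn (a 0) (b 0)) b a)).
  apply/pauli_groupP; do 3 eexists; split; last by [].
  by rewrite exprMn al mul1r sgn_exp4.
rewrite !mul_kernel_op; apply: eq_kernel_op => x y.
rewrite /weyl sum_mulrb_eql (eq_bigr (fun z : bits 1 =>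
  (alpha * \prod_q sgn (b q) (z q)) *+ (z == y + a) *
  ((sqrtC 2)^-1 * sgn (x 0) (z 0)))); last first.
  by move=> z _; rewrite mulrC eq_addr_bits.
rewrite sum_mulrb_eql !big_ord_recl !big_ord0 !mulr1 ord0E !bits_addE.
rewrite !sgnDr sgnDl (sgnC (b 0) (a 0)) (sgnC (x 0) (a 0)); ring.
Qed.

(** The product is a single two-qubit Clifford operation, so it counts once. *)
Definition attach_gate (e f : bool) : operator C 2 := cz e *m cnot f.

Lemma clifford_attach_gate e f : clifford (attach_gate e f).
Proof. exact: clifford_mul (clifford_cz e) (clifford_cnot f). Qed.

Lemma attach_gateE e f : attach_gate e f = kernel_op (fun x y : bits 2 =>
  sgn (x 0) (e * x 1%R) *+ (y == flip_target f x)).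
Proof.
rewrite /attach_gate mul_kernel_op; apply: eq_kernel_op => x y.
by rewrite sum_mulrb_eql mulr_natr.
Qed.

(** * Gates acting on amplitudes *)

Lemma amplitude_act_on k m (f : 'I_k -> 'I_m) (K : bits k -> bits k -> C)
    (psi : state C m) x :
  amplitude (act_on f (kernel_op K) *m psi) x =
  \sum_(y : bits m) (K [ffun a => x (f a)] [ffun a => y (f a)]
    *+ [forall q, (q \notin codom f) ==> (x q == y q)]) * amplitude psi y.
Proof.
rewrite -(amplitude_mul (fun x y : bits m =>
  K [ffun a => x (f a)] [ffun a => y (f a)]
    *+ [forall q, (q \notin codom f) ==> (x q == y q)])).
congr (amplitude (_ *m _) _).
by apply/matrixP => i j; rewrite !mxE !index_ofK.
Qed.

Lemma amplitude_attach m (q r : 'I_m) e f (psi : state C m) x : q != r ->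
  amplitude (act_on (fun a : 'I_2 => if a == 0 then q else r)
    (attach_gate e f) *m psi) x =
  sgn (x q) (e * x r) * amplitude psi (x + unit_bit q (x r *+ f)).
Proof.
move=> qr; rewrite attach_gateE amplitude_act_on.
set g := fun a : 'I_2 => if a == 0 then q else r.
rewrite -(sum_mulrb_eql (fun=> sgn (x q) (e * x r))); apply: eq_bigr => y _.
rewrite -mulrnA mulnb !ffunE; congr (_ *+ nat_of_bool _ * _).
apply/andP/eqP => [[/eqP/ffunP E /forallP out]|->].
  apply/ffunP => p; rewrite bits_addE.
  have [->|pq] := eqVneq p q.
    by have := E 0; rewrite /flip_target !bits_addE !unit_bit_same !ffunE.
  rewrite unit_bit_other // addr0.
  have [->|pr] := eqVneq p r.
    by have := E 1; rewrite /flip_target !bits_addE unit_bit_other // !ffunE addr0.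
  apply/esym/eqP/(implyP (out p)); apply/negP => /codomP[a pE].
  by move: pE pq pr; rewrite /g; case: (a == 0) => ->; rewrite eqxx.
split.
  apply/eqP/ffunP => a; rewrite /flip_target bits_addE !ffunE /g.
  have [->|->] := I2_cases a; first by rewrite /= eqxx.
  by rewrite /= (eq_sym r) (negPf qr).
apply/forallP => p; apply/implyP => pg; rewrite bits_addE unit_bit_other ?addr0 //.
by apply: contraNneq pg => ->; apply/codomP; exists 0.
Qed.

(** With qubit [q] in the state |0>, only one term survives: adding [unit_bit q (x q)] clears bit
    [q] of [x]. *)
Lemma amplitude_hadamard m (q : 'I_m) (psi : state C m) x :
  (forall y : bits m, y q = 1 -> amplitude psi y = 0) ->
  amplitude (act_on (fun _ : 'I_1 => q) hadamard *m psi) x =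
  (sqrtC 2)^-1 * amplitude psi (x + unit_bit q (x q)).
Proof.
move=> psi0; rewrite amplitude_act_on (bigD1 (x + unit_bit q (x q))) //=.
rewrite !ffunE eqxx I2_addrr sgnC sgn0 mulr1.
rewrite (_ : [forall _, _] = true); last first.
  apply/forallP => p; apply/implyP => pq; rewrite bits_addE unit_bit_other ?addr0 //.
  by apply: contraNneq pq => ->; apply/codomP; exists 0.
rewrite big1 ?addr0 // => y yx.
have [y0|/psi0->] := I2_cases (y q); last by rewrite mulr0.
case: forallP => [out|_]; last by rewrite mul0r.
case/eqP: yx; apply/ffunP => p; rewrite bits_addE.
have [->|pq] := eqVneq p q; first by rewrite unit_bit_same I2_addrr.
rewrite unit_bit_other // addr0; apply/esym/eqP/(implyP (out p)).
by apply/negP => /codomP[_ pE]; rewrite pE eqxx in pq.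
Qed.

(** * Graph states on a subset of the qubits *)

(* The vector satisfies the stabilizer equations of the graph [A] at the
   vertices of [W]; the other qubits are in the state |0>. *)
Definition graph_state_on m (W : {set 'I_m}) (A : rel 'I_m) (psi : state C m) :=
  [/\ sqnorm psi = 1,
      forall t (x : bits m), t \in W -> amplitude psi (x + unit_bit t 1) =
        (\prod_u sgn (A t u) (x u)) * amplitude psi x
    & forall t (x : bits m), t \notin W -> x t = 1 -> amplitude psi x = 0].

Lemma graph_state_on_zero m A : graph_state_on finset.set0 A (zero_state C m).
Proof.
have amp x : amplitude (zero_state C m) x = (x == 0)%:R.
  rewrite /amplitude mxE eqxx andbT (can_eq (@index_ofK m)).
  by congr (_ == _)%:R; apply/ffunP => q; rewrite !ffunE.
split=> [|t x|t x _ xt]; last 2 first.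
- by rewrite inE.
- by rewrite amp; case: eqP => // x0; rewrite x0 ffunE in xt.
rewrite sqnorm_amplitude (bigD1 (0 : bits m)) //= amp eqxx normr1 expr1n big1 ?addr0 //.
by move=> x /negPf x0; rewrite amp x0 normr0 expr0n.
Qed.

Lemma graph_state_on_hadamard m (W : {set 'I_m}) A v psi :
  v \notin W -> (forall t, A v t = false) -> (forall t, A t v = false) ->
  graph_state_on W A psi ->
  graph_state_on (v |: W) A (act_on (fun _ : 'I_1 => v) hadamard *m psi).
Proof.
move=> vW Av vA [norm1 stab supp].
have ampH x := amplitude_hadamard x (supp v ^~ vW).
split=> [|t x|t x].
- rewrite sqnorm_amplitude.
  have half : `|(sqrtC 2)^-1| ^+ 2 = 2^-1 :> C.
    by rewrite ger0_norm ?invr_ge0 ?sqrtC_ge0 // exprVn sqrtCK.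
  have norm0 : \sum_(x : bits m | x v == 0) `|amplitude psi x| ^+ 2 = 1.
    rewrite -norm1 sqnorm_amplitude [RHS](bigID (fun x : bits m => x v == 0)) /=.
    rewrite [X in _ + X]big1 ?addr0 // => x xv.
    have [x0|x1] := I2_cases (x v); first by rewrite x0 in xv.
    by rewrite (supp v) // normr0 expr0n.
  under eq_bigr => x _ do rewrite ampH normrM exprMn half.
  (* The labels with bit [v] equal to 0 and those with it equal to 1 each contribute one half. *)
  rewrite -mulr_sumr (bigID (fun x : bits m => x v == 0)) /=.
  rewrite [X in _ * (_ + X)](reindex_inj (addIr (unit_bit v 1))) /=.
  have E1 : \sum_(x : bits m | x v == 0) `|amplitude psi (x + unit_bit v (x v))| ^+ 2 = 1.
    by rewrite -norm0; apply: eq_bigr => x /eqP->; rewrite unit_bit0 addr0.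
  rewrite E1 (eq_big (fun x : bits m => x v == 0)
    (fun x => `|amplitude psi x| ^+ 2)) ?norm0 ?mulVf ?pnatr_eq0 // => x.
    by rewrite bits_addE unit_bit_same; case: (I2_cases (x v)) => ->.
  rewrite bits_addE unit_bit_same => xv.
  have -> : x v = 0 by case: (I2_cases (x v)) xv => ->.
  by rewrite add0r bits_addK.
- rewrite !inE !ampH => /orP[/eqP->|tW].
    rewrite big1 ?mul1r => [|u _]; last by rewrite Av sgn0.
    congr (_ * amplitude _ _).
    by rewrite bits_addE unit_bit_same unit_bitD addrACA bits_addrr addr0.
  have vt : v != t by apply: contraNneq vW => ->.
  rewrite bits_addE unit_bit_other // addr0 addrAC stab // mulrCA; congr (_ * _).
  apply: eq_bigr => u _; rewrite bits_addE.
  have [->|uv] := eqVneq u v; first by rewrite vA !sgn0.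
  by rewrite unit_bit_other // addr0.
- rewrite !inE negb_or ampH => /andP[tv tW] xt.
  by rewrite (supp t) ?mulr0 // bits_addE unit_bit_other // addr0.
Qed.

Lemma prod_sgn_add m (w : 'I_m) (a : 'I_m -> bool) (x : bits m) c :
  \prod_u sgn (a u) ((x + unit_bit w c)%R u) =
  \prod_u sgn (a u) (x u) * sgn (a w) c.
Proof.
under eq_bigr => u _ do rewrite bits_addE sgnDr.
rewrite big_split /=; congr (_ * _).
rewrite (bigD1 w) //= unit_bit_same big1 ?mulr1 // => u uw.
by rewrite unit_bit_other // sgnC.
Qed.

Lemma prod_sgn_if m (v : 'I_m) (a : 'I_m -> bool) b (x : bits m) : a v = false ->
  \prod_u sgn (if u == v then b else a u) (x u) =
  sgn b (x v) * \prod_u sgn (a u) (x u).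
Proof.
move=> av; rewrite (bigD1 v) //= eqxx [in RHS](bigD1 v) //= av sgn0 mul1r.
by congr (_ * _); apply: eq_bigr => u /negPf->.
Qed.

Lemma sgn_mulr1 a e : sgn a (e * (1 : 'I_2)%R) = sgn e a.
Proof. by rewrite /sgn /= muln1 mulnC. Qed.

(** The new amplitude at x is (-1)^(e x_v x_w) times the old one with x_w replaced by x_w + f x_v.
    Flipping x_v thus brings in the stabilizer of [w] if [f] holds, and the sign of e x_w. Flipping
    another x_t keeps row [t] of [A], adding f A(t,w) x_v from the shift, and e x_v when t = w. *)
Lemma graph_state_on_attach m (W : {set 'I_m}) (A B : rel 'I_m) v w e f psi :
    v \in W -> w \in W -> w != v ->
    (forall t, A v t = false) -> (forall t, A t v = false) -> A w w = false ->
    (forall t, B v t = if t == w then e else f && A w t) ->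
    (forall t, t != v -> B t v = if t == w then e else f && A t w) ->
    (forall t u, t != v -> u != v -> B t u = A t u) ->
  graph_state_on W A psi ->
  graph_state_on W B
    (act_on (fun a : 'I_2 => if a == 0 then w else v) (attach_gate e f) *m psi).
Proof.
move=> vW wW wv Av vA Aww Bv vB BA [norm1 stab supp].
have ampA x := amplitude_attach e f psi x wv.
have vw : v != w by rewrite eq_sym.
split=> [|t x tW|t x tW xt].
- rewrite -norm1 !sqnorm_amplitude.
  pose tau (x : bits m) := x + unit_bit w (x v *+ f).
  have tauK : involutive tau.
    by move=> x; rewrite /tau bits_addE (unit_bit_other _ vw) addr0 bits_addK.
  rewrite [RHS](reindex_inj (inv_inj tauK)) /=; apply: eq_bigr => x _.
  by rewrite ampA normrM normr_sgn mul1r.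
- rewrite !ampA; have [->|tv] := eqVneq t v.
    rewrite !bits_addE unit_bit_same (unit_bit_other _ wv) addr0.
    rewrite mulrnDl unit_bitD addrAC addrA stab //.
    rewrite big1 ?mul1r => [|u _]; last by rewrite Av sgn0.
    have -> : amplitude psi (x + unit_bit w (x v *+ f) + unit_bit w (1 *+ f)) =
        \prod_u sgn (f && A w u) (x u) * amplitude psi (x + unit_bit w (x v *+ f)).
      case: (f) => /=; last by rewrite unit_bit0 addr0 big1 ?mul1r.
      by rewrite stab // prod_sgn_add Aww sgn0 mulr1.
    have -> : \prod_u sgn (B v u) (x u) =
        \prod_u sgn (if u == w then e else f && A w u) (x u).
      by apply: eq_bigr => u _; rewrite Bv.
    rewrite (prod_sgn_if (a := fun u => f && A w u)) ?Aww ?andbF //.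
    rewrite sgn_mulDr sgn_mulr1; ring.
  rewrite !bits_addE [unit_bit t 1 v]unit_bit_other 1?eq_sym // addr0.
  rewrite addrAC stab // prod_sgn_add.
  have -> : \prod_u sgn (B t u) (x u) =
      \prod_u sgn (if u == v then B t v else A t u) (x u).
    by apply: eq_bigr => u _; case: eqVneq => [->//|uv]; rewrite BA.
  rewrite (prod_sgn_if (a := A t)) // vB //.
  have [->|tw] := eqVneq t w.
    rewrite Aww sgn0 unit_bit_same sgnDl (sgnCA (1%R : 'I_2)) sgn_mulr1.
    ring.
  rewrite unit_bit_other 1?eq_sym // addr0.
  have -> : sgn (A t w) (x v *+ f)%R = sgn (f && A t w) (x v).
    by case: (f); rewrite ?mulr1n // mulr0n sgnC.
  ring.
- have tw : t != w by apply: contraNneq tW => ->.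
  by rewrite ampA (supp t) ?mulr0 // bits_addE unit_bit_other // addr0.
Qed.

(** * Circuits for buildable graphs *)

Lemma stabilizerE m (G : sgraph 'I_m) v : stabilizer C G v =
  kernel_op (fun x y : bits m =>
    (\prod_u sgn (G v u) (x u)) *+ (y == x + unit_bit v 1)).
Proof.
apply/matrixP => i j; rewrite !mxE.
have -> : (label j == label i + unit_bit v 1) =
    [forall q, label j q == label i q + unit_bit v 1 q].
  apply/eqP/forallP => [-> q|E]; first by rewrite bits_addE.
  by apply/ffunP => q; rewrite bits_addE (eqP (E q)).
rewrite -prod_mulrb; apply: eq_bigr => q _; rewrite unit_bitE.
have [->|qv] := eqVneq q v.
  rewrite adj_irrefl sgn0 mxE.
  by case: (I2_cases (label i v)) => ->; case: (I2_cases (label j v)) => ->.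
by rewrite addr0 [label j q == _]eq_sym; case: (G v q); rewrite mxE // /sgn mul1n.
Qed.

Lemma is_graph_state_on m (G : sgraph 'I_m) psi :
  graph_state_on [set: 'I_m] G psi -> is_graph_state G psi.
Proof.
case=> norm1 stab _; rewrite /is_graph_state norm1 eqxx /=.
apply/forallP => v; apply/eqP/state_eq => x.
rewrite stabilizerE amplitude_mul sum_mulrb_eql stab ?finset.in_setT // mulrA.
by rewrite -big_split big1 ?mul1r // => u _; rewrite /= sgn_mulrr.
Qed.

(** Keeping all qubits, with those outside [W] isolated, provides what [graph_state_on_hadamard]
    asks of the next vertex. *)
Definition induced m (G : sgraph 'I_m) (W : {set 'I_m}) : rel 'I_m :=
  fun t u => [&& G t u, t \in W & u \in W].

(** An [algorithm] grows at its front, so a circuit is represented by the function [F] that puts its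
    gates before a continuation. The first vertex costs only a Hadamard gate, each later one a
    single two-qubit gate. *)
Lemma buildable_circuit n (G : sgraph 'I_n) (W : {set 'I_n}) : buildable G W ->
  (0 < #|W|)%N /\
  exists (F : algorithm C n n -> algorithm C n n) (psi : state C n),
  [/\ forall X, cz_complexity (F X) = (cz_complexity X + #|W|.-1)%N,
      forall good X, success_probability good (F X) (zero_state C n) =
        success_probability good X psi
    & graph_state_on W (induced G W) psi].
Proof.
elim=> {W} [v|W v w f _ [W0 [F [psi [czF runF gsF]]]] vW wW att].
  rewrite cards1; split=> //.
  exists (Gate1 clifford_hadamard v), (act_on (fun=> v) hadamard *m zero_state C n).
  split=> [X||]; [by rewrite addn0|by []|].
  rewrite -[[set v]]finset.setU0; apply: graph_state_on_hadamard.
  - by rewrite inE.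
  - move=> t; rewrite /induced finset.setU0 !inE eqxx /=.
    by case: eqP => [->|]; rewrite ?andbF ?adj_irrefl.
  - move=> t; rewrite /induced finset.setU0 !inE eqxx andbT.
    by case: eqP => [->|]; rewrite ?andbF ?adj_irrefl.
  - exact: graph_state_on_zero.
have wv : w != v by apply: contraNneq vW => <-.
have cardvW : #|v |: W| = #|W|.+1 by rewrite cardsU1 vW.
split; first by rewrite cardvW.
exists (fun X => F (Gate1 clifford_hadamard v
  (Gate2 (clifford_attach_gate (G v w) f) wv X))).
exists (act_on (fun a : 'I_2 => if a == 0 then w else v) (attach_gate (G v w) f)
  *m (act_on (fun=> v) hadamard *m psi)).
split=> [X|good X|]; first by rewrite czF cardvW /= addSnnS prednK.
  by rewrite runF.
apply: (graph_state_on_attach (A := induced G W)) => //; rewrite ?/induced.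
- by rewrite !inE eqxx.
- by rewrite !inE wW orbT.
- by move=> t; rewrite (negPf vW) andbF.
- by move=> t; rewrite (negPf vW) !andbF.
- by rewrite adj_irrefl.
- move=> t; rewrite !inE eqxx /=; case: eqVneq => [->|tv].
    by rewrite eq_sym (negPf wv) (negPf vW) !andbF adj_irrefl.
  case: eqVneq => [->|tw]; first by rewrite wW andbT.
  rewrite wW /=; case tW: (t \in W); rewrite ?andbF // !andbT.
  exact: att.
- move=> t tv; rewrite !inE eqxx (negPf tv) /= andbT.
  case: eqVneq => [->|tw]; first by rewrite wW andbT (adj_sym G).
  rewrite wW andbT; case tW: (t \in W); rewrite ?andbF // !andbT.
  by rewrite !(adj_sym G t) att.
- by move=> t u tv uv; rewrite !inE (negPf tv) (negPf uv).
- apply: graph_state_on_hadamard => // t; by rewrite /induced (negPf vW) !andbF.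
Qed.

End Operators.

Lemma generates_graph_state (C : numClosedFieldType) n (G : sgraph 'I_n) :
  rank_width G = 1%N ->
  (0 < n)%N /\ exists A : algorithm C n (n + 0),
    generates A G /\ cz_complexity A = n.-1.
Proof.
move=> /rank_width1_buildable /(buildable_circuit C).
rewrite cardsT card_ord => -[n0 [F [psi [czF runF gs]]]]; split=> //.
(* The types at [n + 0] and [n] are not convertible, so the register size is generalized. *)
suff gen m : n = m -> exists A : algorithm C n m,
    success_probability (is_graph_state G) A (zero_state C m) = 1 /\
    cz_complexity A = n.-1 by apply: gen; rewrite addn0.
move=> nm; case: m / nm; exists (F (Stop C n)); split; last by rewrite czF.
rewrite runF /= is_graph_state_on //.
case: gs => norm1 stab supp; split=> // t x tT; rewrite stab //.
by congr (_ * _); apply: eq_bigr => u _; rewrite /induced !finset.in_setT !andbT.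
Qed.

Theorem corollary5 (R : realType) (n : nat) (G : sgraph 'I_n)
    (rwG : rank_width G = 1%N) :
  (Gamma_CZ R G <= (n%:R - 1)%:E)%E.
Proof.
have [n0 [A [genA czA]]] := generates_graph_state R[i] rwG.
apply: ereal_inf_lbound; exists 0%N, A; split=> //.
(* By [n0], truncated subtraction agrees with subtraction in [R]. *)
by rewrite czA -subn1 natrB.
Qed.
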